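(* Let $\{T_j\}_{j=1,\dots,J}$ be a family of tessellations, each covering $\mathbb{R}^k$, and let $0<\lambda<1$. If the space $\bigcup_{j=1}^{J}\chi(T_j)$ is refinable (with scale $\lambda$), then the tessellation obtained by intersecting the $T_j$, $j=1,\dots,J$, does not contain a cell straddling a cell facet of any coarser-scaled copy $\lambda^{-n}T_i$ ($n\ge 1$) of any $T_i$, $i\in\{1,\dots,J\}$.
   Context: A tessellation $T$ of $\mathbb{R}^k$ is a locally finite family of full-dimensional convex polytopes (the cells) that cover $\mathbb{R}^k$ and have pairwise disjoint interiors; its facets are the $(k-1)$-dimensional faces of its cells. For $\mu>0$, $\mu T=\{\mu c : c\in T\}$. $\chi(T)$ denotes the space of indicator functions of the cells of $T$. The space $\bigcup_{j}\chi(T_j)$ is refinable with scale $\lambda$ if, for every $i$, the indicator function of every cell of $T_i$ is a linear combination of functions in $\bigcup_{j=1}^{J}\chi(\lambda T_j)$, i.e. of indicator functions of cells of the scaled tessellations $\lambda T_1,\dots,\lambda T_J$. Linear combinations may be infinite (the sums are locally finite), and equality of functions is understood almost everywhere. The tessellation obtained by intersecting $\{T_j\}$ has as cells all sets $c_1\cap\dots\cap c_J$ with $c_j\in T_j$ that have nonempty interior. A cell straddles a facet if the facet meets the interior of the cell. *)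

(* Defs.v *)
From HB Require Import structures.
From mathcomp Require Import all_boot all_order all_algebra.
From mathcomp Require Import all_classical all_reals all_analysis.

Set Implicit Arguments.
Unset Strict Implicit.
Unset Printing Implicit Defensive.

Import Order.TTheory GRing.Theory Num.Theory.
Import numFieldNormedType.Exports.

Local Open Scope classical_set_scope.
Local Open Scope ring_scope.

(** [R^k] is ['rV[R]_k] for [R : realType]. *)

Definition convex_hull (R : realType) (k n : nat) (v : 'I_n -> 'rV[R]_k) :
    set 'rV[R]_k :=
  [set x | exists w : 'I_n -> R,
     [/\ forall i, 0 <= w i, \sum_i w i = 1 & x = \sum_i w i *: v i]].

Definition polytope (R : realType) (k : nat) (P : set 'rV[R]_k) : Prop :=
  exists (n : nat) (v : 'I_n -> 'rV[R]_k), P = convex_hull v.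

(** The affine hull of [A] is [x0] + (row space of [D]) and has dimension [d];
    in particular [A] is nonempty. *)
Definition has_dim (R : realType) (k : nat) (A : set 'rV[R]_k) (d : nat) :
    Prop :=
  exists (x0 : 'rV[R]_k) (D : 'M[R]_(d, k)),
    [/\ A x0, row_free D, forall i, A (x0 + row i D) &
        forall y, A y -> (y - x0 <= D)%MS].

(** The linear functional is [x |-> x *m a]. *)
Definition face (R : realType) (k : nat) (P F : set 'rV[R]_k) : Prop :=
  exists (a : 'cV[R]_k) (b : R),
    (forall x, P x -> (x *m a) 0 0 <= b) /\
    F = P `&` [set x | (x *m a) 0 0 = b].

(** [k.-1] would be wrong at [k = 0]: a point has no facet. *)
Definition facet (R : realType) (k : nat) (P F : set 'rV[R]_k) : Prop :=
  face P F /\ exists2 d, d.+1 = k & has_dim F d.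

Definition locally_finite (X : topologicalType) (T : set (set X)) : Prop :=
  forall x : X, exists2 U, nbhs x U &
    finite_set [set c | T c /\ c `&` U !=set0].

Definition tessellation (R : realType) (k : nat) (T : set (set 'rV[R]_k)) :
    Prop :=
  [/\ forall c, T c -> polytope c /\ has_dim c k,
      locally_finite T,
      \bigcup_(c in T) c = setT &
      forall c d, T c -> T d -> c <> d -> c° `&` d° = set0].

Definition tess_scale (R : realType) (k : nat) (mu : R)
    (T : set (set 'rV[R]_k)) : set (set 'rV[R]_k) :=
  [set [set mu *: x | x in c] | c in T].

Definition tess_facet (R : realType) (k : nat) (T : set (set 'rV[R]_k))
    (F : set 'rV[R]_k) : Prop :=
  exists2 c, T c & facet c F.

Definition tess_inter (R : realType) (k J : nat)
    (T : 'I_J -> set (set 'rV[R]_k)) : set (set 'rV[R]_k) :=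
  [set d | exists c : 'I_J -> set 'rV[R]_k,
     [/\ forall j, T j (c j), d = \bigcap_j c j & d° !=set0]].

Definition straddles (R : realType) (k : nat) (c F : set 'rV[R]_k) : Prop :=
  F `&` c° !=set0.

Definition box (R : realType) (k : nat) (lo hi : 'rV[R]_k) : set 'rV[R]_k :=
  [set x | forall i, lo 0 i <= x 0 i <= hi 0 i].

Definition box_volume (R : realType) (k : nat) (lo hi : 'rV[R]_k) : R :=
  \prod_i (hi 0 i - lo 0 i).

(** Sets of [k]-dimensional Lebesgue (outer) measure zero.  The predicate [P]
    allows finite and empty covers; this only matters for [k = 0], where every
    box has volume 1. *)
Definition lebesgue_null (R : realType) (k : nat) (A : set 'rV[R]_k) : Prop :=
  forall e : R, 0 < e ->
    exists (P : pred nat) (lo hi : nat -> 'rV[R]_k),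
      [/\ forall n i, lo n 0 i <= hi n 0 i,
          A `<=` \bigcup_(n in [set n | P n]) box (lo n) (hi n) &
          (\sum_(0 <= n <oo | P n) (box_volume (lo n) (hi n))%:E <= e%:E)%E].

Definition eq_lebesgue_ae (R : realType) (k : nat) (f g : 'rV[R]_k -> R) :
    Prop :=
  lebesgue_null [set x | f x <> g x].

Definition chi (R : realType) (k : nat) (T : set (set 'rV[R]_k)) :
    set ('rV[R]_k -> R) :=
  [set \1_c | c in T].

(** Possibly infinite linear combinations, evaluated pointwise.  The sum over a
    set is a finite-support sum (0 if the support is infinite); for the
    indicator functions of finitely many locally finite families, only finitely
    many terms are nonzero at each [x]. *)
Definition lin_comb (R : realType) (k : nat) (G : set ('rV[R]_k -> R))
    (a : ('rV[R]_k -> R) -> R) : 'rV[R]_k -> R :=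
  fun x => \sum_(g \in G) a g * g x.

Definition refinable (R : realType) (k J : nat)
    (T : 'I_J -> set (set 'rV[R]_k)) (lambda : R) : Prop :=
  forall (i : 'I_J) (c : set 'rV[R]_k), T i c ->
    exists a : ('rV[R]_k -> R) -> R,
      eq_lebesgue_ae \1_c
        (lin_comb (\bigcup_j chi (tess_scale lambda (T j))) a).

(* Main.v *)
Require Import Defs.
From HB Require Import structures.
From mathcomp Require Import all_boot all_order all_algebra.
From mathcomp Require Import all_classical all_reals all_analysis.
From mathcomp Require Import measurable_realfun.
Import Order.TTheory GRing.Theory Num.Theory.
Import numFieldNormedType.Exports.
Local Open Scope classical_set_scope.
Local Open Scope ring_scope.

(** A linear combination of cell indicators of the [lambda T_j] is constant on
    the interior of a cell [e] of their intersection, because each [lambda T_j]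
    has a single cell meeting that interior.  By refinability the indicator of a
    cell [c] of [T_i] is then a.e. constant there, and since [c] is closed and
    its interior is dense in it, the interior of [e] lies in the interior of [c]
    or misses [c].  Iterating, [lambda ^ n] maps the interior of a cell of the
    intersection into the interior of such a cell and, for [n >= 1], either into
    the interior of [c] or away from [c], while a facet of [c] lies in [c] and
    misses its interior. *)

(** * Continuity of affine maps *)

Lemma continuous_subr (R : realType) (V : normedModType R) (c : V) :
  continuous (fun y : V => y - c).
Proof. by move=> y; apply: cvgB; [exact: cvg_id|exact: cvg_cst]. Qed.

Lemma continuous_homothety (R : realType) (V : normedModType R) (a : R) (c : V) :
  continuous (fun y : V => c + a *: (y - c)).
Proof.
move=> y; apply: cvgD; first exact: cvg_cst.
by apply: cvgZr; exact: continuous_subr.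
Qed.

Lemma cvg_segment0 (R : realType) (V : normedModType R) (x z : V) :
  (fun t : R => x + t *: (z - x)) @ (0 : R)^'+ --> x.
Proof.
rewrite -[X in _ --> X]addr0 -(scale0r (z - x)).
apply: cvg_at_right_filter; apply: cvgD; first exact: cvg_cst.
exact: scalel_continuous.
Qed.

Lemma continuous_mulmxr (R : realType) (n k : nat) (M : 'M[R]_(n, k)) :
  continuous (fun v : 'rV[R]_n => v *m M).
Proof.
rewrite (_ : (fun v => _) = (fun v : 'rV[R]_n => \sum_i v 0 i *: row i M)); last first.
  by apply/funext => v; rewrite mulmx_sum_row.
apply: continuous_big; first exact: add_continuous.
move=> i _ v; apply: (continuous_comp (g := fun a : R => a *: row i M)).
  exact: coord_continuous.
exact: scalel_continuous.
Qed.

(** * Polytopes: compactness, convexity and interior points *)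

(** The hull is the image of the standard simplex [S] under a linear map, and [S] is a closed subset
    of a compact cube. *)
Lemma convex_hull_compact (R : realType) (k n : nat) (v : 'I_n -> 'rV[R]_k) :
  compact (convex_hull v).
Proof.
pose S := [set w : 'rV[R]_n | (forall i, 0 <= w 0 i <= 1) /\ \sum_i w 0 i = 1].
have -> : convex_hull v = (fun w : 'rV[R]_n => w *m \matrix_i v i) @` S.
  apply/seteqP; split=> x.
    move=> [w [w0 w1 ->]]; exists (\row_i w i); last first.
      by rewrite mulmx_sum_row; apply: eq_bigr => i _; rewrite mxE rowK.
    split=> [i|]; last by rewrite -[RHS]w1; apply: eq_bigr => i _; rewrite mxE.
    by rewrite mxE w0/= -w1 (bigD1 i)//= lerDl sumr_ge0.
  move=> [w [w01 w1] <-]; exists (fun i => w 0 i); split => //.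
    by move=> i; have /andP[] := w01 i.
  by rewrite mulmx_sum_row; apply: eq_bigr => i _; rewrite rowK.
apply: continuous_compact.
  by apply: continuous_subspaceT; exact: continuous_mulmxr.
apply: (subclosed_compact (B := [set w : 'rV[R]_n | forall i, `[0, 1]%classic (w ord0 i)])).
- rewrite (_ : S = (\bigcap_i [set w : 'rV[R]_n | `[0, 1]%classic (w 0 i)]) `&`
      [set w | \sum_i w 0 i = 1]); last first.
    apply/seteqP; split=> w /=.
      by move=> [w01 w1]; split=> // i _ /=; rewrite in_itv/=.
    by move=> [w01 w1]; split=> // i; have := w01 i Logic.I; rewrite /= in_itv.
  apply: closedI.
    apply: closed_bigI => i _; apply: preimage_closed; last exact: interval_closed.
    by move=> w _; exact: coord_continuous.
  apply: (preimage_closed (D := [set 1]) (f := fun w : 'rV[R]_n => \sum_i w 0 i)).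
    move=> w _; apply: continuous_big; first exact: add_continuous.
    by move=> i _; exact: coord_continuous.
  exact: closed_eq.
- exact: (@rV_compact R n (fun=> `[0, 1]%classic) (fun=> @segment_compact R 0 1)).
- by move=> w [w01 _] i; rewrite /= in_itv/=; exact: w01.
Qed.

Lemma convex_hull_comb {R : realType} {k n m : nat} {v : 'I_n -> 'rV[R]_k}
    (u : 'I_m -> R) (p : 'I_m -> 'rV[R]_k) :
  (forall j, 0 <= u j) -> \sum_j u j = 1 -> (forall j, convex_hull v (p j)) ->
  convex_hull v (\sum_j u j *: p j).
Proof.
move=> u0 u1 /choice[w hw]; exists (fun i => \sum_j u j * w j i); split.
- move=> i; apply: sumr_ge0 => j _; apply: mulr_ge0 => //.
  by have [+ _ _] := hw j; apply.
- rewrite exchange_big/= -[RHS]u1; apply: eq_bigr => j _.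
  by have [_ w1 _] := hw j; rewrite -mulr_sumr w1 mulr1.
- under [RHS]eq_bigr do rewrite scaler_suml.
  rewrite [RHS]exchange_big/=; apply: eq_bigr => j _.
  have [_ _ ->] := hw j; rewrite scaler_sumr; apply: eq_bigr => i _.
  by rewrite scalerA.
Qed.

Lemma polytope_closed {R : realType} {k : nat} {c : set 'rV[R]_k} :
  polytope c -> closed c.
Proof.
move=> [n [v ->]]; apply: compact_closed; first exact: norm_hausdorff.
exact: convex_hull_compact.
Qed.

Lemma polytope_convex {R : realType} {k : nat} {c : set 'rV[R]_k}
    {x y : 'rV[R]_k} {t : R} :
  polytope c -> c x -> c y -> 0 <= t <= 1 -> c ((1 - t) *: x + t *: y).
Proof.
move=> [n [v ->]] cx cy /andP[t0 t1].
have := @convex_hull_comb _ _ _ 2 v (fun i => if i == 0 then 1 - t else t)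
  (fun i => if i == 0 then x else y).
rewrite !big_ord_recl !big_ord0/= !addr0; apply.
- by move=> j; case: ifP => // _; rewrite subr_ge0.
- by rewrite subrK.
- by move=> j; case: ifP.
Qed.

(** The points [x0] and [x0 + row i D] are the vertices of a nondegenerate simplex inside the
    polytope, and the barycentre of that simplex is an interior point. *)
Lemma full_dim_polytope_interior {R : realType} {k : nat} {c : set 'rV[R]_k} :
  polytope c -> has_dim c k -> c° !=set0.
Proof.
move=> [n [v ->]] [x0 [D [cx0 Dfree cD _]]].
have Du : D \in unitmx by rewrite -row_free_unit.
pose f (y : 'rV[R]_k) := (y - x0) *m invmx D.
have fc i : continuous (fun y => f y 0 i).
  move=> y; have := @continuous_mulmxr R _ _ (invmx D) (y - x0).
  move=> /(continuous_comp (@continuous_subr _ _ x0 y)) fy.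
  exact: (continuous_comp fy (@coord_continuous _ _ _ 0 i _)).
(* When all [k] coordinates equal [a], the weight left for [x0] is [a] as well, hence positive, also
   for [k = 0]. *)
pose a : R := k.+1%:R^-1.
have a0 : 0 < a by rewrite invr_gt0.
pose p := x0 + const_mx a *m D.
have fp : f p = const_mx a by rewrite /f/p addrC addKr mulmxK.
exists p.
have pos1 i : \forall y \near p, 0 < f y 0 i.
  by have := fc i p; move=> /cvgr_gt; apply; rewrite fp mxE.
have pos : \forall y \near p, forall i, 0 < f y 0 i by exact: filter_forall pos1.
have lt1 : \forall y \near p, \sum_i f y 0 i < 1.
  have : (fun y => \sum_i f y 0 i) @ p --> \sum_i f p 0 i.
    apply: continuous_big; first exact: add_continuous.
    by move=> i _; exact: fc.
  move=> /cvgr_lt; apply; rewrite fp.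
  under eq_bigr do rewrite mxE.
  by rewrite sumr_const card_ord -mulr_natl ltr_pdivrMr// mul1r ltr_nat.
near=> y.
have y0 : forall i, 0 < f y 0 i by near: y.
have y1 : \sum_i f y 0 i < 1 by near: y.
(* Barycentric coordinates of [y]: index 0 stands for [x0] and takes the remaining weight. *)
pose u (j : 'I_k.+1) := if unlift ord0 j is Some i then f y 0 i
  else 1 - \sum_i f y 0 i.
pose q (j : 'I_k.+1) := if unlift ord0 j is Some i then x0 + row i D else x0.
have -> : y = \sum_j u j *: q j.
  rewrite big_ord_recl/= /u/q unlift_none.
  under [X in _ + X]eq_bigr do rewrite liftK scalerDr.
  rewrite big_split/= -scaler_suml addrA -scalerDl subrK scale1r -mulmx_sum_row.
  by rewrite /f mulmxKV// addrC subrK.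
apply: convex_hull_comb.
- by move=> j; rewrite /u; case: unlift => [i|]; [exact: ltW|rewrite subr_ge0 ltW].
- rewrite big_ord_recl/= /u unlift_none.
  by under [X in _ + X]eq_bigr do rewrite liftK; rewrite subrK.
- by move=> j; rewrite /q; case: unlift.
Unshelve. all: by end_near.
Qed.

(** By convexity, the homothety with centre [x] and small ratio [t] carries a neighbourhood of an
    interior point [z] into [c], and it moves [z] into [U]. *)
Lemma full_dim_polytope_interior_dense {R : realType} {k : nat}
    {c U : set 'rV[R]_k} {x : 'rV[R]_k} :
  polytope c -> has_dim c k -> c x -> open U -> U x -> (c° `&` U) !=set0.
Proof.
move=> pc dc cx oU Ux; have [z cz] := full_dim_polytope_interior pc dc.
have : \forall t \near (0 : R)^'+, U (x + t *: (z - x)).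
  by apply: (cvg_segment0 _ _ x z); exact: open_nbhs_nbhs.
move=> Ut; near (0 : R)^'+ => t.
have t0 : 0 < t by near: t; exact: nbhs_right_gt.
have t1 : t <= 1 by near: t; exact: nbhs_right_le.
exists (x + t *: (z - x)); split; last by near: t.
(* [g] inverts the homothety, so [w] is a convex combination of [x] and [g w]. *)
pose g (w : 'rV[R]_k) := x + t^-1 *: (w - x).
have gc : continuous g by exact: continuous_homothety.
have gz : g (x + t *: (z - x)) = z.
  by rewrite /g addrAC subrr add0r scalerA mulVf ?gt_eqF// scale1r addrC subrK.
have := gc (x + t *: (z - x)); rewrite /continuous_at gz => /(_ _ cz) near_c.
have := @filterS _ (nbhs (x + t *: (z - x))) _ _ c _ near_c; apply => w /= cgw.
have -> : w = (1 - t) *: x + t *: g w.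
  rewrite /g scalerDr scalerA mulfV ?gt_eqF// scale1r addrA -scalerDl subrK.
  by rewrite scale1r addrC subrK.
by apply: polytope_convex => //; rewrite ltW.
Unshelve. all: by end_near.
Qed.

(** * Nonempty open sets are not Lebesgue null *)

(* Fubini-style induction: the inequality for the slices at height [t] of the
   last coordinate is integrated over [t]. *)
Lemma box_cover_volume (R : realType) (m : nat) (l h : nat -> R) (P : pred nat)
    (lo hi : nat -> nat -> R) :
  (forall i, l i <= h i) -> (forall n i, lo n i <= hi n i) ->
  (forall x : nat -> R, (forall i, (i < m)%N -> l i <= x i <= h i) ->
     exists2 n, P n & forall i, (i < m)%N -> lo n i <= x i <= hi n i) ->
  ((\prod_(i < m) (h i - l i))%:E <=
   \sum_(0 <= n <oo | P n) (\prod_(i < m) (hi n i - lo n i))%:E)%E.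
Proof.
move=> lh lohi; elim: m P => [|m IH] P cov.
  (* In dimension 0 every box has volume 1, so one index of the cover suffices. *)
  have [n Pn _] := cov l (fun _ => ltac:(by [])).
  rewrite big_ord0; under eq_eseriesr do rewrite big_ord0.
  apply: (@le_trans _ _ (\sum_(0 <= i < n.+1 | P i) (1%:E : \bar R))%E).
    rewrite big_mkcond big_nat_recr//= Pn -[leLHS]add0e leeD2r// sume_ge0//.
    by move=> i _; case: ifP; rewrite ?lee_fin.
  by apply: nneseries_lim_ge => i _ _; rewrite lee_fin.
pose V n := \prod_(i < m) (hi n i - lo n i).
have V0 n : 0 <= V n by apply: prodr_ge0 => i _; rewrite subr_ge0.
pose I n := `[lo n m, hi n m]%classic : set R.
pose D := `[l m, h m]%classic : set R.
pose mu := @lebesgue_measure R.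
(* The volume of the slice of box [n] at height [t]; [P] is absorbed into the coefficient, which
   leaves an unconditional series. *)
pose F n (t : R) : \bar R := ((if P n then V n else 0)%:E * (\1_(I n) t)%:E)%E.
have c0 n : 0 <= (if P n then V n else 0) by case: ifP.
have F0 n t : (0 <= F n t)%E by rewrite mule_ge0// lee_fin.
have mI n : measurable (I n) by exact: measurable_itv.
have mD : measurable D by exact: measurable_itv.
have m1 n : measurable_fun D (EFin \o (\1_(I n) : R -> R)).
  by apply/measurable_EFinP; exact: measurable_indic.
have mF n : measurable_fun D (F n).
  exact: (@measurable_funeM _ _ _ D _ (if P n then V n else 0)%:E (m1 n)).
have slice t : D t -> ((\prod_(i < m) (h i - l i))%:E <=
    \sum_(0 <= n <oo) F n t)%E.
  rewrite /D/= in_itv/= => Dt.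
  (* The slice is covered by the boxes whose last side contains [t]; this smaller index set is why
     the induction generalizes over [P]. *)
  have -> : (\sum_(0 <= n <oo) F n t =
      \sum_(0 <= n <oo | P n && (t \in I n)) (V n)%:E)%E.
    rewrite [RHS]eseries_mkcond; apply: eq_eseriesr => n _.
    rewrite /F indicE; case: (P n) => /=; last by rewrite mul0e.
    by case: (t \in I n); rewrite ?mule1 ?mule0.
  apply: IH => x hx.
  have [|n Pn hn] := cov (fun i => if i == m then t else x i).
    move=> i; rewrite ltnS leq_eqVlt; case: eqVneq => [-> //|_ /=]; exact: hx.
  exists n.
    by rewrite Pn/= mem_setE in_itv/=; have := hn m (ltnSn m); rewrite eqxx.
  move=> i im; have := hn i (ltnW im).
  by rewrite ltn_eqF.
have itvE (a b : R) : a <= b -> mu `[a, b]%classic = (b - a)%:E.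
  rewrite /mu lebesgue_measure_itv/= lte_fin le_eqVlt => /predU1P[->|->].
    by rewrite ltxx subrr.
  by rewrite EFinB.
rewrite big_ord_recr/= EFinM -itvE// -integral_cst//.
have mS : measurable_fun D (fun t => \sum_(0 <= n <oo) F n t)%E.
  exact: ge0_emeasurable_sum.
have P0 : 0 <= \prod_(i < m) (h i - l i).
  by apply: prodr_ge0 => i _; rewrite subr_ge0.
have /le_trans : (\int[mu]_(x in D) cst (\prod_(i < m) (h i - l i))%:E x <=
    \int[mu]_(x in D) \sum_(0 <= n <oo) F n x)%E.
  by apply: ge0_le_integral => //= t _; rewrite lee_fin.
apply.
rewrite integral_nneseries// [leRHS]eseries_mkcond.
apply: lee_nneseries => [n _ _|n _].
  exact: integral_ge0.
have i0 t : D t -> (0 <= (EFin \o (\1_(I n) : R -> R)) t)%E by rewrite lee_fin.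
rewrite (ge0_integralZl_EFin mu mD i0 (m1 n) (c0 n)).
(* The last side of a box may stick out of [D], so only an inequality remains at the end. *)
rewrite (_ : \int[mu]_(x in D) _ = mu (I n `&` D))%E; last exact: (@integral_indic _ _ _ mu _ mD _ (mI n)).
case: ifP => Pn; last by rewrite mul0e.
rewrite big_ord_recr/= EFinM lee_wpmul2l ?lee_fin//.
rewrite -itvE//; apply: le_measure; last exact: subIsetl.
  have mID : measurable (I n `&` D) by exact: measurableI.
  exact/mem_set.
exact/mem_set.
Qed.

(** A cube of side [e] inside [U] has volume [e ^+ k], too much for a cover of total volume
    [e ^+ k / 2]. *)
Lemma open_not_lebesgue_null {R : realType} {k : nat} {U : set 'rV[R]_k} :
  open U -> U !=set0 -> ~ lebesgue_null U.
Proof.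
move=> oU [x Ux] nU.
have [e e0 eU] : nbhs_ball x U by apply/nbhs_ballP; exact: open_nbhs_nbhs.
(* Coordinates are padded with 0 beyond [k], as [box_cover_volume] indexes them by [nat]. *)
pose ext (v : 'rV[R]_k) (i : nat) : R := oapp (v 0) 0 (insub i).
have extE v (i : 'I_k) : ext v i = v 0 i by rewrite /ext valK.
have ext_le (v w : 'rV[R]_k) : (forall i, v 0 i <= w 0 i) ->
    forall i, ext v i <= ext w i.
  by move=> vw i; rewrite /ext; case: insub => //=.
have e20 : 0 < e / 2 by rewrite divr_gt0.
have ek0 : 0 < e ^+ k / 2 by rewrite divr_gt0// exprn_gt0.
have [P [lo [hi [lohi cover small]]]] := nU _ ek0.
have vol (v w : 'rV[R]_k) :
    \prod_(i < k) (ext w i - ext v i) = box_volume v w.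
  by apply: eq_bigr => i _; rewrite !extE.
have /le_trans/(_ small) : ((box_volume (x - const_mx (e / 2))
      (x + const_mx (e / 2)))%:E <=
    \sum_(0 <= n <oo | P n) (box_volume (lo n) (hi n))%:E)%E.
  rewrite -vol; under eq_eseriesr do rewrite -vol.
  apply: (@box_cover_volume _ _ _ _ _ (fun n => ext (lo n)) (fun n => ext (hi n))).
  - by apply: ext_le => i; rewrite !mxE lerD2l ge0_cp// ltW.
  - by move=> n; apply: ext_le.
  move=> y yx.
  have /eU/cover[n Pn yn] : ball x e (\row_(i < k) y i).
    split=> // i j; rewrite ord1 mxE; have := yx j (ltn_ord j).
    rewrite !extE !mxE /ball/= -ler_distlC => /le_lt_trans; apply.
    by rewrite ltr_pdivrMr// ltr_pMr// ltr1n.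
  exists n => // i ik; have := yn (Ordinal ik).
  by rewrite mxE -[i]/(val (Ordinal ik)) !extE.
have -> : box_volume (x - const_mx (e / 2)) (x + const_mx (e / 2)) = e ^+ k.
  rewrite /box_volume -[k in RHS]card_ord -prodr_const.
  apply: eq_bigr => i _; rewrite !mxE opprD opprK addrACA subrr add0r.
  by rewrite -splitr.
by rewrite lee_fin leNgt ltr_pdivrMr ?ltr_pMr ?ltr1n ?exprn_gt0.
Qed.

(** * Behaviour of cells under scaling *)

(** The interior of [c'] is dense in [c'], so [x] yields a point common to both interiors. *)
Lemma tessellation_cell_unique {R : realType} {k : nat} {T : set (set 'rV[R]_k)}
    {c c' : set 'rV[R]_k} {x : 'rV[R]_k} :
  tessellation T -> T c -> T c' -> c° x -> c' x -> c' = c.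
Proof.
move=> [polyT _ _ disjT] Tc Tc' cx c'x.
apply: contrapT => /(disjT _ _ Tc' Tc) c'c0; have [pc' dc'] := polyT _ Tc'.
have [y] := full_dim_polytope_interior_dense pc' dc' c'x (open_interior c) cx.
by rewrite c'c0.
Qed.

Lemma bigcap_interior_sub {X : topologicalType} {I : Type} (c : I -> set X)
    (j : I) :
  (\bigcap_j c j)° `<=` (c j)°.
Proof. by apply: interiorS; exact: bigcap_inf. Qed.

Lemma lin_comb_const_on_inter (R : realType) (k J : nat)
    (T : 'I_J -> set (set 'rV[R]_k)) (lambda : R) (a : ('rV[R]_k -> R) -> R)
    (d : set 'rV[R]_k) (x y : 'rV[R]_k) :
  (forall j, tessellation (T j)) -> lambda != 0 -> tess_inter T d ->
  d° x -> d° y ->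
  lin_comb (\bigcup_j chi (tess_scale lambda (T j))) a (lambda *: x) =
  lin_comb (\bigcup_j chi (tess_scale lambda (T j))) a (lambda *: y).
Proof.
move=> hT l0 [c [Tc -> _]] dx dy; apply: eq_fsbigr => g.
rewrite inE => -[j _ [_ [c' Tc' <-] <-]]; congr (_ * _).
(* At scaled points of [d°], the indicator of a scaled cell only records whether that cell comes
   from [c j]. *)
suff scaled_indic z : (\bigcap_j c j)° z ->
    \1_[set lambda *: x | x in c'] (lambda *: z) = (c' == c j)%:R :> R.
  by rewrite !scaled_indic.
move=> dz; have cz : (c j)° z by exact: bigcap_interior_sub dz.
rewrite indicE; congr (_%:R : R); congr nat_of_bool.
apply/idP/eqP.
  rewrite inE => -[z' c'z' /(scalerI l0) z'z]; rewrite z'z in c'z'.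
  exact: tessellation_cell_unique (hT j) (Tc j) Tc' cz c'z'.
by move=> ->; rewrite inE; exists z => //; exact: interior_subset.
Qed.

Lemma open_scale_preimage {R : realType} {V : normedModType R} (a : R)
    {U : set V} : open U -> open [set x | U (a *: x)].
Proof.
by move=> oU; apply: (open_comp _ oU) => x _; exact: scaler_continuous.
Qed.

(** If the constant value of the combination on the scaled [d°] is 1, the part outside [c] is open
    and null, hence empty. Otherwise the part inside [c°] is empty, and density of [c°] in [c]
    excludes the rest of [c]. *)
Lemma scaled_cell_dichotomy {R : realType} {k J : nat}
    {T : 'I_J -> set (set 'rV[R]_k)} {lambda : R} {i : 'I_J}
    {c d : set 'rV[R]_k} :
  (forall j, tessellation (T j)) -> 0 < lambda -> refinable T lambda ->
  tess_inter T d -> T i c ->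
  (forall x, d° x -> c° (lambda *: x)) \/ (forall x, d° x -> ~ c (lambda *: x)).
Proof.
move=> hT l0 href Td Tc; have ln0 := lt0r_neq0 l0.
have [polyT _ _ _] := hT i; have [pc dc] := polyT _ Tc.
(* [U] is [d°] scaled by [lambda], written as a preimage to make it visibly open. *)
pose U := [set y : 'rV[R]_k | d° (lambda^-1 *: y)].
have oU : open U by apply: open_scale_preimage; exact: open_interior.
have dU x : d° x -> U (lambda *: x) by rewrite /U/= scalerA mulVf// scale1r.
have [a hnull] := href i c Tc.
pose f := lin_comb (\bigcup_j chi (tess_scale lambda (T j))) a.
have [x0 dx0] : d° !=set0 by case: Td => ? [].
have fU y : U y -> f y = f (lambda *: x0).
  move=> Uy; rewrite -[y in LHS](scalerKV ln0).
  exact: (lin_comb_const_on_inter _ _ _ _ _ a _ _ _ hT ln0 Td Uy dx0).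
(* Such a [V] is an open subset of the null set on which refinability leaves the two functions
   different. *)
have null_empty (V : set 'rV[R]_k) : open V -> V `<=` U ->
    (forall y, V y -> \1_c y <> f (lambda *: x0)) -> V = set0.
  move=> oV VU Vf; apply/seteqP; split=> // y Vy.
  have []// := open_not_lebesgue_null oV (ex_intro _ y Vy).
  move=> e e0; have [P [lo [hi [lohi cov small]]]] := hnull e e0.
  exists P, lo, hi; split=> // z Vz; apply: cov => /=.
  by rewrite -/f fU; [exact: Vf|exact: VU].
have [f1|f1] := eqVneq (f (lambda *: x0)) 1; [left|right].
  have Uc0 : U `&` ~` c = set0.
    apply: null_empty; [|exact: subIsetl|].
      by apply: openI => //; rewrite openC; exact: polytope_closed.
    move=> y [_ ncy]; rewrite f1 indicE memNset//=.
    by apply/eqP; rewrite eq_sym oner_eq0.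
  have Uc : U `<=` c.
    by move=> y Uy; apply: contrapT => ncy; rewrite -[False]/(set0 y) -Uc0.
  by move=> x /dU Ux; move: Uc; rewrite open_subsetE//; apply.
have Uc0 : c° `&` U = set0.
  apply: null_empty; [|exact: subIsetr|].
    by apply: openI => //; exact: open_interior.
  move=> y [/interior_subset cy _]; rewrite indicE mem_set//=.
  by apply/eqP; rewrite eq_sym.
move=> x /dU Ux cx.
have [y] := full_dim_polytope_interior_dense pc dc cx oU Ux.
by rewrite Uc0.
Qed.

(** It suffices to choose cells through the single point [lambda *: x0]: this point refutes the
    second alternative of [scaled_cell_dichotomy] for each of them. *)
Lemma tess_inter_refined {R : realType} {k J : nat}
    {T : 'I_J -> set (set 'rV[R]_k)} {lambda : R} {d : set 'rV[R]_k} :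
  (forall j, tessellation (T j)) -> 0 < lambda -> refinable T lambda ->
  tess_inter T d ->
  exists2 d', tess_inter T d' & forall x, d° x -> d'° (lambda *: x).
Proof.
move=> hT l0 href Td; have [x0 dx0] : d° !=set0 by case: Td => ? [].
have /choice[c hc] : forall j, exists c, T j c /\ c (lambda *: x0).
  move=> j; have [_ _ cov _] := hT j.
  have : setT (lambda *: x0) by [].
  by rewrite -cov => -[c Tc cx]; exists c.
have dc x : d° x -> (\bigcap_j c j)° (lambda *: x).
  move=> dx; pose U := [set y : 'rV[R]_k | d° (lambda^-1 *: y)].
  have oU : open U by apply: open_scale_preimage; exact: open_interior.
  have : U `<=` \bigcap_j c j.
    move=> y Uy j _; have [Tc cx0] := hc j.
    have [/(_ _ Uy)|/(_ _ dx0)//] := scaled_cell_dichotomy hT l0 href Td Tc.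
    by rewrite scalerKV ?gt_eqF// => /interior_subset.
  rewrite open_subsetE//; apply.
  by rewrite /U/= scalerA mulVf ?scale1r ?gt_eqF.
exists (\bigcap_j c j) => //; exists c; split=> //.
  by move=> j; have [] := hc j.
by exists (lambda *: x0); exact: dc.
Qed.

Lemma tess_inter_refined_iter {R : realType} {k J : nat}
    {T : 'I_J -> set (set 'rV[R]_k)} {lambda : R} (m : nat)
    {d : set 'rV[R]_k} :
  (forall j, tessellation (T j)) -> 0 < lambda -> refinable T lambda ->
  tess_inter T d ->
  exists2 d', tess_inter T d' & forall x, d° x -> d'° (lambda ^+ m *: x).
Proof.
move=> hT l0 href Td; elim: m => [|m [d' Td' dd']].
  by exists d => // x dx; rewrite expr0 scale1r.
have [d'' Td'' d'd''] := tess_inter_refined hT l0 href Td'.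
by exists d'' => // x dx; rewrite exprS -scalerA; apply/d'd''/dd'.
Qed.

(** * Facets and the final contradiction *)

(** A linear functional with a maximum at an interior point vanishes. The facet would then contain a
    short segment from [x] in every direction, which its dimension forbids. *)
Lemma facet_interior_disjoint {R : realType} {k : nat} {c F : set 'rV[R]_k} :
  facet c F -> F `&` c° = set0.
Proof.
move=> [[a [b [cb FE]]] [m mk [x0 [D [Fx0 _ _ FD]]]]].
apply/seteqP; split=> // x [Fx cx]; exfalso.
have xb : (x *m a) 0 0 = b by move: Fx; rewrite FE => -[].
have near_x (v : 'rV[R]_k) : exists2 t : R, 0 < t & c (x + t *: v).
  have xv : \forall t \near (0 : R)^'+, c (x + t *: (x + v - x)).
    exact: (cvg_segment0 _ _ x (x + v) _ cx).
  near (0 : R)^'+ => t; exists t; first by near: t; exact: nbhs_right_gt.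
  have -> : v = x + v - x by rewrite addrC addKr.
  by near: t.
(* The bound applies to both [v] and [- v]. *)
have av0 (v : 'rV[R]_k) : (v *m a) 0 0 = 0.
  have av_le (w : 'rV[R]_k) : (w *m a) 0 0 <= 0.
    have [t t0 /cb] := near_x w.
    by rewrite mulmxDl mxE xb gerDl -scalemxAl mxE pmulr_rle0.
  apply/eqP; rewrite eq_le av_le/=.
  by have := av_le (- v); rewrite mulNmx mxE oppr_le0.
have vD (v : 'rV[R]_k) : (v <= D)%MS.
  have [t t0 cxv] := near_x v.
  have Fxv : F (x + t *: v).
    by rewrite FE; split=> //=; rewrite mulmxDl mxE xb av0 addr0.
  have : (t *: v <= D)%MS.
    have -> : t *: v = (x + t *: v - x0) - (x - x0).
      by rewrite opprB addrA subrK addrAC subrr add0r.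
    by apply: addmx_sub; rewrite ?eqmx_opp; exact: FD.
  by rewrite eqmx_scale ?gt_eqF.
(* The rank of [D] would be at least [k], but [D] has only [k - 1] rows. *)
have : (1%:M <= D)%MS by apply/row_subP => i; exact: vD.
move=> /mxrankS; rewrite mxrank1 => /leq_trans/(_ (rank_leq_row D)).
by rewrite -[X in (X <= _)%N]mk ltnn.
Unshelve. all: by end_near.
Qed.

Theorem corollary4 (R : realType) (k J : nat)
    (T : 'I_J -> set (set 'rV[R]_k)) (lambda : R)
    (hT : forall j, tessellation (T j))
    (hlambda0 : 0 < lambda) (hlambda1 : lambda < 1)
    (hrefinable : refinable T lambda) :
  forall (n : nat) (i : 'I_J) (d F : set 'rV[R]_k),
    (1 <= n)%N ->
    tess_inter T d ->
    tess_facet (tess_scale (lambda ^- n) (T i)) F ->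
    ~ straddles d F.
Proof.
move=> [//|m] i d F _ Td [_ [c Tc <-] Fc] [x [Fx dx]].
have ln0 : lambda ^+ m.+1 != 0 by rewrite expf_neq0 ?gt_eqF.
(* With [n = m.+1], only [m] scalings are spent here; the dichotomy for [d'] supplies the last one,
   which is where [1 <= n] enters. *)
have [d' Td' /(_ x dx) d'x] := tess_inter_refined_iter m hT hlambda0 hrefinable Td.
have [/(_ _ d'x)|/(_ _ d'x)] := scaled_cell_dichotomy hT hlambda0 hrefinable Td' Tc;
  rewrite scalerA -exprS => cx.
  (* First alternative: [x] is interior to the scaled cell, hence not on its facet. *)
  have : F `&` [set lambda ^- m.+1 *: y | y in c]° !=set0.
    exists x; split=> //.
    have : [set y : 'rV[R]_k | c° (lambda ^+ m.+1 *: y)] `<=`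
        [set lambda ^- m.+1 *: y | y in c].
      move=> y /interior_subset cy; exists (lambda ^+ m.+1 *: y) => //.
      by rewrite scalerA mulVf// scale1r.
    rewrite open_subsetE; first exact.
    by apply: open_scale_preimage; exact: open_interior.
  by rewrite (facet_interior_disjoint Fc) => -[].
(* Second alternative: the facet is part of the scaled cell, so scaling [x] back lands in [c]. *)
have [[a [b [_ FE]]] _] := Fc; apply: cx.
move: Fx; rewrite FE => -[[y cy <-] _].
by rewrite scalerA mulfV// scale1r.
Qed.
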